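(* Let $k$ be an integer with $3\le k<200$, and let $A$ be a cyclically $k$-diagonal array of size $n>k$. Then $P(A)$ has a solution if and only if $n$ and $k$ are both odd.
   Context: Arrays are toroidal: an $n\times n$ array has rows and columns indexed modulo $n$ (representatives $1,\dots,n$). Each cell is filled or empty; $F(A)$ is the set of filled cells. For $(i,j)\in F(A)$: - the row successor $s_r((i,j))$ is $(i,j+k)$ with $k\ge1$ minimal such that $(i,j+k)\in F(A)$; - the column successor $s_c((i,j))$ is $(i+k,j)$ with $k\ge1$ minimal such that $(i+k,j)\in F(A)$. Given $R\in\{-1,1\}^n$ and $C\in\{-1,1\}^n$, the move function is $S_{R,C}((i,j))=s_c^{\,c_{j'}}((i,j'))$, where $(i,j')=s_r^{\,r_i}((i,j))$; exponent $-1$ means inverse. $R,C$ is a solution of $P(A)$ if $S_{R,C}$ is a single cycle on $F(A)$. ''$P(A)$ has a solution'' means such $R,C$ exist. Diagonals: the $i$-th diagonal of a square array of size $n$ is $D_i=\{(i+t-1,t): t=1,\dots,n\}$, with row indices modulo $n$. An array of size $n\ge k$ is $k$-diagonal if its filled cells are exactly the cells of $k$ distinct diagonals. It is cyclically $k$-diagonal (with $n>k$) if, in addition, the filled diagonals are consecutive modulo $n$, i.e. $D_i,D_{i+1},\dots,D_{i+k-1}$ for some $i$. *)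

(* Defs.v *)
From mathcomp Require Import all_boot all_order all_algebra all_fingroup.

Set Implicit Arguments.
Unset Strict Implicit.
Unset Printing Implicit Defensive.

(* An n x n array is recorded by its filled (true) / empty (false) pattern.
   Rows and columns are numbered from 0 to n - 1 instead of 1 to n. *)
Definition array (n : nat) := 'M[bool]_n.

Definition filled n (A : array n) : {set 'I_n * 'I_n} := [set x | A x.1 x.2].

(* i + m modulo n *)
Definition shift n (i : 'I_n) (m : nat) : 'I_n := iter m (@ordS n) i.

Lemma val_shift n (i : 'I_n) m : shift i m = (i + m) %% n :> nat.
Proof.
rewrite /shift; elim: m => [|m IHm] /=; first by rewrite addn0 modn_small.
by rewrite IHm -addn1 modnDml addn1 addnS.
Qed.

Lemma shift_inj n m : injective (fun i : 'I_n => shift i m).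
Proof. by elim: m => [|m IHm] i j //= /ordS_inj /IHm. Qed.

Lemma shiftD n (i : 'I_n) m p : shift (shift i m) p = shift i (m + p).
Proof. by rewrite /shift addnC iterD. Qed.

Lemma shift_size n (i : 'I_n) : shift i n = i.
Proof. by apply: val_inj; rewrite /= val_shift modnDr modn_small. Qed.

(* The minimal m >= 1 such that P (i + m); it is at most n when P i holds. *)
Definition gap n (P : pred 'I_n) (i : 'I_n) : nat :=
  (find (fun m => P (shift i m.+1)) (iota 0 n)).+1.

(* Indices outside P are fixed, so that the successor is a permutation. *)
Definition next_in n (P : pred 'I_n) (i : 'I_n) : 'I_n :=
  if P i then shift i (gap P i) else i.

Lemma gapP n (P : pred 'I_n) (i : 'I_n) : P i ->
  [/\ 0 < gap P i, P (shift i (gap P i)) &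
      forall m, 0 < m -> P (shift i m) -> gap P i <= m].
Proof.
move=> Pi; have n_gt0 : 0 < n by apply: leq_ltn_trans (ltn_ord i).
set Q := fun m => P (shift i m.+1).
have hasQ : has Q (iota 0 n).
  apply/hasP; exists n.-1; first by rewrite mem_iota ltn_predL.
  by rewrite /Q prednK // shift_size.
have lt_n : find Q (iota 0 n) < n by rewrite -[ltnRHS](size_iota 0) -has_find.
split=> //; first by have := nth_find 0 hasQ; rewrite nth_iota.
case=> [|m] // _ Pm; rewrite /gap ltnS leqNgt; apply/negP => lt_m.
have := before_find 0 lt_m.
by rewrite nth_iota ?(ltn_trans lt_m) // add0n /Q Pm.
Qed.

Lemma next_in_inj n (P : pred 'I_n) : injective (next_in P).
Proof.
move=> i j; rewrite /next_in.
case: ifP => [Pi|nPi]; case: ifP => [Pj|nPj] //; first 1 last.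
- by move=> eq_ij; case: (gapP Pi) => _; rewrite eq_ij nPj.
- by move=> eq_ij; case: (gapP Pj) => _; rewrite -eq_ij nPi.
wlog le_ij : i j Pi Pj / gap P i <= gap P j => [IH|].
  case/orP: (leq_total (gap P i) (gap P j)) => le_ij; first exact: IH.
  by move/esym/IH => ->.
rewrite -(subnK le_ij) -shiftD => /shift_inj eq_i.
have [eq_d | d_gt0] := posnP (gap P j - gap P i); first by rewrite eq_i eq_d.
have [i_gt0 _ _] := gapP Pi; have [_ _ /(_ _ d_gt0)] := gapP Pj.
by rewrite -eq_i => /(_ Pi); rewrite leqNgt -subn_gt0 subKn // i_gt0.
Qed.

Section Successors.

Variables (n : nat) (A : array n).

Definition row_succ_fun (x : 'I_n * 'I_n) : 'I_n * 'I_n :=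
  (x.1, next_in (fun j => (x.1, j) \in filled A) x.2).

Definition col_succ_fun (x : 'I_n * 'I_n) : 'I_n * 'I_n :=
  (next_in (fun i => (i, x.2) \in filled A) x.1, x.2).

Lemma row_succ_inj : injective row_succ_fun.
Proof. by move=> [i j] [i' j'] [/= <- /next_in_inj ->]. Qed.

Lemma col_succ_inj : injective col_succ_fun.
Proof. by move=> [i j] [i' j'] [/= + eq_j]; rewrite -eq_j => /next_in_inj ->. Qed.

(* Both fix every empty cell; only their restriction to F(A) is meaningful. *)
Definition row_succ : {perm 'I_n * 'I_n} := perm row_succ_inj.
Definition col_succ : {perm 'I_n * 'I_n} := perm col_succ_inj.

End Successors.

Definition perm_expz (T : finType) (s : {perm T}) (e : int) : {perm T} :=
  match e with
  | Posz m => (s ^+ m)%g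
  | Negz m => (s ^- m.+1)%g
  end.

Definition move_fun n (A : array n) (R C : {ffun 'I_n -> int})
    (x : 'I_n * 'I_n) : 'I_n * 'I_n :=
  let y := perm_expz (row_succ A) (R x.1) x in
  perm_expz (col_succ A) (C y.2) y.

Definition sign_vector n (R : {ffun 'I_n -> int}) : Prop :=
  forall i, R i = 1%R \/ R i = (-1)%R.

Definition single_cycle_on (T : finType) (f : T -> T) (D : {set T}) : Prop :=
  exists2 p : seq T, ufcycle f p & p =i D.

Definition is_solution n (A : array n) (R C : {ffun 'I_n -> int}) : Prop :=
  [/\ sign_vector R, sign_vector C & single_cycle_on (move_fun A R C) (filled A)].

Definition has_solution n (A : array n) : Prop :=
  exists R C : {ffun 'I_n -> int}, is_solution A R C.

(* Numbered from 0 like rows and columns: diagonal i here is D_(i+1). *)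
Definition diagonal n (i : 'I_n) : {set 'I_n * 'I_n} :=
  [set (shift i t, t) | t : 'I_n].

Definition k_diagonal n (k : nat) (A : array n) : Prop :=
  exists2 I : {set 'I_n}, #|I| = k & filled A = \bigcup_(i in I) diagonal i.

Definition cyclically_diagonal n (k : nat) (A : array n) : Prop :=
  [/\ k < n, k_diagonal k A &
      exists i : 'I_n, filled A = \bigcup_(m < k) diagonal (shift i m)].

(* Main.v *)
Require Import Defs.
From mathcomp Require Import all_boot all_order all_algebra all_fingroup.
From mathcomp Require Import zify ring.

(* Necessity is a parity argument: reversing some rows or columns multiplies the row
   and column successors by squares, and reflection in the antidiagonal conjugates the
   row successor to the inverse of the column successor.  So a move permutation is
   even, while a cycle on the nk filled cells is even only if nk is odd.

   For sufficiency let d = k - 1 and g = gcd(n, d), take all rows forward, and reverse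
   exactly the columns of a set E.  Number the filled diagonals by m mod k.  A move
   from diagonal m > 0 goes to the next column, a move from diagonal 0 goes back d
   columns, and diagonal m changes to m - 2 exactly when the new column is in E.
   Since k is odd, the tour visits the columns of E on diagonal 0 by iterating
   x |-> (d-th successor in E of the first return of x to E under translation by -d).
   Translation by -d has the classes modulo g as its orbits, so on a class meeting E in
   one or two points the first return does not depend on n, and on a class with three
   points it is one of the two 3-cycles.  It remains to find, for each even d < 199 and
   odd g dividing d, a set E meeting every class for which this map is a single cycle:
   an interval {0, ..., g + t - 1} with t < 5 does, except when g = 3 and d is one of
   ten values. *)

Set Implicit Arguments.
Unset Strict Implicit.
Unset Printing Implicit Defensive.

(** * Shifts and successors of indices modulo n *)

Lemma shift_eqE n (i : 'I_n) p q : (shift i p == shift i q) = (p == q %[mod n]).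
Proof. by rewrite -val_eqE /= !val_shift eqn_modDl. Qed.

Lemma shiftC n (i j : 'I_n) : shift i j = shift j i.
Proof. by apply: val_inj; rewrite /= !val_shift addnC. Qed.

(** [rev_ord] is i |-> n - 1 - i, so it turns a shift by p into a shift by -p; shifts only go
    forward, hence p is added back. *)
Lemma shift_rev n (i : 'I_n) p : shift (rev_ord (shift i p)) p = rev_ord i.
Proof.
elim: p i => [|p IHp] i //.
rewrite -[RHS]IHp -{2}(add1n p) -{1}(addn1 p) -2!shiftD; congr (shift _ p).
apply: ord_inj; move: (shift i p) => j.
have lt_j := ltn_ord j.
rewrite val_shift; have := val_shift j 1; move: (shift j 1) => j1 /= ->.
have [eq_n|lt_n] := eqVneq (j + 1) n.
  by rewrite eq_n modnn subn1 addn1 prednK ?modnn //; lia.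
by rewrite (modn_small (m := j + 1)) ?modn_small; lia.
Qed.

Lemma next_in_eq n (P : pred 'I_n) (i : 'I_n) g :
    P i -> 0 < g -> P (shift i g) ->
    (forall q, 0 < q < g -> ~~ P (shift i q)) ->
  next_in P i = shift i g.
Proof.
move=> Pi g_gt0 Pg minP; rewrite /next_in Pi; have [p_gt0 Pp] := gapP Pi.
move=> /(_ g g_gt0 Pg) le_pg; congr (shift i _); apply/eqP.
rewrite eqn_leq le_pg leqNgt; apply/negP => lt_pg.
by have := minP _ (introT andP (conj p_gt0 lt_pg)); rewrite Pp.
Qed.

(** * Parity of partially reversed permutations and of cycles *)

Section Flip.

Variables (T : finType) (s : {perm T}) (b : pred T).
Hypothesis bs : forall x, b (s x) = b x.

Let bV x : b (s^-1 x)%g = b x.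
Proof. by rewrite -{2}(permKV s x) bs. Qed.

Definition flip_fun x := if b x then (s^-1)%g x else s x.

Lemma flip_inj : injective flip_fun.
Proof.
move=> x y; rewrite /flip_fun; case: ifP => bx; case: ifP => // by_.
- exact: perm_inj.
- by move=> eq_xy; rewrite -bV eq_xy bs by_ in bx.
- by move=> eq_xy; rewrite -bs eq_xy bV by_ in bx.
exact: perm_inj.
Qed.

Definition flip : {perm T} := perm flip_inj.

Lemma flipE x : flip x = if b x then (s^-1)%g x else s x.
Proof. by rewrite permE. Qed.

(** Applying this map twice undoes s two times on b, which after s leaves the inverse of s there. *)
Lemma unflip_inj : injective (fun x => if b x then (s^-1)%g x else x).
Proof.
move=> x y; case: ifP => bx; case: ifP => // by_; first exact: perm_inj.
  by move=> eq_xy; rewrite -bV eq_xy by_ in bx.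
by move=> eq_xy; rewrite eq_xy bV by_ in bx.
Qed.

(* [flip] differs from [s] by the square of a permutation. *)
Lemma odd_flip : odd_perm flip = odd_perm s.
Proof.
have -> : flip = (s * (perm unflip_inj * perm unflip_inj))%g.
  apply/permP => x; rewrite flipE !permM.
  have unflipE y : perm unflip_inj y = if b y then (s^-1)%g y else y.
    by rewrite permE.
  rewrite (unflipE (s x)) bs.
  by have [bx|/negPf bx] := boolP (b x); rewrite unflipE ?permK ?bs ?bx.
by rewrite odd_permM odd_permM addbb addbF.
Qed.

End Flip.

(** The orbits are D itself and the singletons outside D, so the number of points minus the number
    of orbits is #|D| - 1. *)
Lemma odd_perm_ufcycle (T : finType) (s : {perm T}) (p : seq T) (D : {set T}) :
    ufcycle s p -> p =i D -> D != set0 ->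
    (forall x, x \notin D -> s x = x) ->
  odd_perm s = ~~ odd #|D|.
Proof.
move=> /andP[cycp uniqp] eqpD D_neq0 fixD.
have porbitE x : porbit s x =i fconnect s x.
  move=> y; rewrite [RHS]inE; apply/porbitP/idP => [[i ->]|/iter_findex <-].
    by rewrite permX fconnect_iter.
  by exists (findex s x y); rewrite permX.
have porbitD x : x \in D -> porbit s x = D.
  move=> xD; apply/setP=> y; rewrite porbitE [LHS]inE.
  by rewrite (fconnect_cycle cycp) -?eqpD ?eqpD.
have porbitC x : x \notin D -> porbit s x = [set x].
  move=> xD; apply/setP=> y; rewrite porbitE [LHS]inE inE.
  by rewrite (@fconnect_cycle _ _ [:: x]) ?inE //= fixD ?eqxx.
have porbitsE : porbits s = D |: [set [set x] | x in ~: D].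
  apply/setP=> B; rewrite in_setU1; apply/imsetP/predU1P => [[x _ ->]|].
    have [/porbitD ->|xD] := boolP (x \in D); [by left | right].
    by rewrite porbitC // imset_f ?inE.
  have /set0Pn[x xD] := D_neq0.
  case=> [->|/imsetP[y yD ->]]; first by exists x; rewrite ?porbitD.
  by exists y; rewrite ?porbitC // -in_setC.
rewrite /odd_perm porbitsE cardsU1 card_imset; last exact: set1_inj.
have -> : D \notin [set [set x] | x in ~: D].
  apply/imsetP => -[x xD eqD].
  by move: xD; rewrite inE eqD set11.
rewrite -(cardsC D) !oddD /=.
by case: (odd #|D|); case: (odd _).
Qed.

(** * Sets of reversed columns that work for every n with a given gcd *)

(* For t <= g this is the first return to E = {0, ..., g + t - 1}: it exchanges the two
   points of each class meeting E twice. *)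
Definition swap_ends g t x := if x < t then x + g else if x < g then x else x - g.

(* For a permutation of a set of s points containing 0 this says that it is an s-cycle. *)
Definition late_return (f : nat -> nat) s := 0 \notin traject f (f 0) s.-1.

(** In an interval starting at 0 every point is its own index, so the d-th successor in E is
    addition of d modulo g + t. *)
Definition contiguous_ok d g t :=
  (t <= g) && late_return (fun x => (swap_ends g t x + d) %% (g + t)) (g + t).

Definition sporadic d :=
  d \in [:: 12; 48; 60; 72; 108; 120; 132; 168; 180; 192].

Lemma ex_contiguous d g : 0 < d < 199 -> ~~ odd d -> odd g -> g %| d ->
  (exists t, contiguous_ok d g t) \/ g = 3 /\ sporadic d.
Proof.
move=> d_bnd even_d odd_g dvd_gd.
(* Existence of t is phrased through [find] to be decided by computation. Listing g < d suffices,
   since an odd divisor of the even d is proper. *)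
have check : all (fun d => all (fun g =>
    (find (contiguous_ok d g) (iota 0 5) < 5) || (g == 3) && sporadic d)
      [seq g <- iota 0 d | odd g && (g %| d)])
  [seq d <- iota 1 198 | ~~ odd d] by vm_compute.
move/allP/(_ d): check; rewrite mem_filter mem_iota even_d => /(_ d_bnd).
move/allP/(_ g); rewrite mem_filter mem_iota odd_g dvd_gd add0n.
have lt_gd : g < d.
  rewrite ltn_neqAle dvdn_leq ?andbT //; last by case/andP: d_bnd.
  by apply: contraNneq even_d => <-.
move=> /(_ lt_gd)/orP[lt5|/andP[/eqP g3 sp]]; [left | by right].
have /hasP[t _ ok_t] : has (contiguous_ok d g) (iota 0 5) by rewrite has_find.
by exists t.
Qed.

Definition advance (E : seq nat) d x := nth 0 E ((index x E + d) %% size E).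

(* What is known, independently of n, of the first return to E under the translation
   by -d of Z/n, where g = gcd(n, d). *)
Definition class_shuffle g (E : seq nat) (sg : nat -> nat) :=
  [/\ {in E, forall x, sg x \in E},
      {in E, forall x, sg x = x %[mod g]},
      {in E &, injective sg}
    & {in E &, forall x y, x = y %[mod g] -> sg x = x -> x = y}].

(** The bound by d = k - 1 keeps E inside {0, ..., n - 1}. Quantifying over all [sg] leaves g as the
    only trace of n. *)
Definition good_columns g d (E : seq nat) :=
  [/\ 0 \in E, sorted ltn E, {in E, forall x, x <= d},
      forall x, exists2 y, y \in E & x = y %[mod g]
    & forall sg, class_shuffle g E sg ->
        late_return (fun x => advance E d (sg x)) (size E)].

Lemma eq_in_late_return (E : seq nat) (f h : nat -> nat) :
    0 \in E -> {in E, forall x, f x \in E} -> {in E, f =1 h} ->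
  late_return f (size E) = late_return h (size E).
Proof.
move=> E0 fE fh; rewrite /late_return -(fh 0) //; congr (~~ (0 \in _)).
elim: (size E).-1 (f 0) (fE 0 E0) => //= m IHm x xE.
by rewrite -fh // IHm // fE.
Qed.

Lemma mem_advance E d x : 0 < size E -> advance E d x \in E.
Proof. by move=> s_gt0; rewrite mem_nth // ltn_mod. Qed.

Lemma advance_inj E d : uniq E -> {in E &, injective (advance E d)}.
Proof.
move=> uE x y xE yE; have s_gt0 : 0 < size E by case: E {uE yE} xE.
move=> /eqP; rewrite nth_uniq ?ltn_mod // eqn_modDr !modn_small ?index_mem //.
by move=> /eqP eq_xy; rewrite -(nth_index 0 xE) eq_xy nth_index.
Qed.

(** By injectivity the first repetition in 0, f 0, f (f 0), ... is a return to 0. If it does not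
    occur before step [size E], the iterates are [size E] distinct points of E. *)
Lemma late_return_covers (E : seq nat) (f : nat -> nat) :
    uniq E -> 0 \in E -> {in E, forall x, f x \in E} -> {in E &, injective f} ->
    late_return f (size E) ->
  {in E, forall x, exists q, x = iter q f 0}.
Proof.
move=> uE E0 fE f_inj late x xE.
have iterE q : iter q f 0 \in E by elim: q => //= q /fE.
have iter_inj p q : p + q < size E -> iter (p + q) f 0 = iter p f 0 -> q = 0.
  elim: p q => [|p IHp] q lt_pq; last first.
    by rewrite addSn /= => /f_inj/IHp; apply=> //; exact: ltnW.
  rewrite add0n; case: q lt_pq => // q lt_q eq0; case/negP: late.
  apply/trajectP; exists q; last by rewrite -iterSr eq0.
  by rewrite add0n in lt_q; lia.
have uT : uniq (traject f 0 (size E)).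
  apply/(uniqP 0) => p q; rewrite !inE size_traject => lt_p lt_q.
  rewrite !nth_traject // => eq_pq.
  wlog le_pq : p q lt_p lt_q eq_pq / p <= q => [IH|].
    by case/orP: (leq_total p q) => /IH; [apply | move=> IH'; apply/esym/IH'].
  rewrite -(subnKC le_pq) in lt_q eq_pq *.
  by rewrite (iter_inj _ _ lt_q (esym eq_pq)) addn0.
have sub : {subset traject f 0 (size E) <= E}.
  by move=> y /trajectP[q _ ->].
have [_ eqE] := uniq_min_size uT sub (eq_leq (esym (size_traject _ _ _))).
by move: xE; rewrite -eqE => /trajectP[q _ ->]; exists q.
Qed.

Lemma eq_mod_close g x y : x < g + g -> y < g + g -> y = x %[mod g] ->
  [\/ y = x, y = x + g | x = y + g].
Proof.
wlog le_xy : x y / x <= y => [IH lt_x lt_y eq_xy|lt_x lt_y /eqP].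
  case/orP: (leq_total x y) => le; first exact: IH.
  by have [->|->|->] := IH y x le lt_y lt_x (esym eq_xy); constructor.
rewrite eqn_mod_dvd // => /dvdnP[[|[|q]] eq_q].
- by constructor 1; lia.
- by constructor 2; lia.
by exfalso; clear -lt_y le_xy eq_q; nia.
Qed.

(** As t <= g, a class meets the interval in one point, which [sg] must fix, or in two points x and
    x + g, which [sg] must exchange because a fixed point would be alone in its class. *)
Lemma good_columns_iota d g t : 0 < g -> g + t <= d.+1 -> contiguous_ok d g t ->
  good_columns g d (iota 0 (g + t)).
Proof.
move=> g_gt0 le_d /andP[le_tg late]; have s_gt0 : 0 < g + t by rewrite addn_gt0 g_gt0.
have memE x : (x \in iota 0 (g + t)) = (x < g + t) by rewrite mem_iota.
split.
- by rewrite memE.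
- exact: iota_ltn_sorted.
- by move=> x; rewrite memE => lt_x; rewrite -ltnS (leq_trans lt_x).
- move=> x; exists (x %% g); rewrite ?modn_mod // memE.
  by rewrite (leq_trans (ltn_pmod _ g_gt0)) ?leq_addr.
move=> sg [sgE sg_mod sg_inj sg_fix].
rewrite (eq_in_late_return (h := fun x => (swap_ends g t x + d) %% (g + t))).
- by rewrite size_iota.
- by rewrite memE.
- by move=> x _; rewrite mem_advance // size_iota.
move=> x xE; rewrite /advance size_iota.
have sxE := sgE x xE; have sx_mod := sg_mod x xE; rewrite !memE in xE sxE.
suff -> : sg x = swap_ends g t x.
  suff lt_y : swap_ends g t x < g + t.
    have := index_uniq 0 _ (iota_uniq 0 (g + t)); rewrite size_iota.
    move=> /(_ _ lt_y); rewrite (nth_iota 0 0 lt_y) => ->.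
    by rewrite nth_iota ?ltn_mod.
  by clear -xE le_tg g_gt0; rewrite /swap_ends; do 2?[case: ifP => ?]; lia.
have fixed y : y < g + t -> x = y %[mod g] -> x != y -> sg x != x.
  move=> lt_y eq_xy; apply: contraNneq => eq_x.
  by rewrite (sg_fix x y) ?memE.
have {sx_mod} eq_sx : [\/ sg x = x, sg x = x + g | x = sg x + g].
  by apply: eq_mod_close sx_mod; apply: leq_trans (_ : g + t <= _); rewrite ?leq_add2l.
have fixS : x < t -> sg x != x.
  by move=> lt_xt; apply: (fixed (x + g)); rewrite ?modnDr // ; clear -lt_xt g_gt0; lia.
have fixB : g <= x -> sg x != x.
  move=> le_gx; apply: (fixed (x - g)).
  - by clear -xE; lia.
  - by rewrite -{1}(subnK le_gx) modnDr.
  by clear -le_gx g_gt0; lia.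
clear -le_tg xE sxE eq_sx fixS fixB.
rewrite /swap_ends; case: ltnP => [lt_xt|ge_xt].
  by move: (fixS lt_xt); case: eq_sx; lia.
by case: ltnP => [lt_xg|ge_xg]; [|move: (fixB ge_xg)]; case: eq_sx; lia.
Qed.

Definition residue_class g (E : seq nat) x := [seq y <- E | y == x %[mod g]].

(** In a cycle of length at most two, successor and predecessor agree; the last hypothesis forbids
    fixed points in a pair. *)
Lemma next_prev_pair (T : eqType) (c : seq T) x y : uniq c -> size c <= 2 ->
    x \in c -> y \in c -> (x = y -> size c <= 1) ->
  y = next c x /\ y = prev c x.
Proof.
case: c => [|a [|b []]] //= => [_ _|/andP[]]; rewrite !inE.
  by move=> /eqP-> /eqP->; rewrite eqxx.
move=> /negPf ab _ _ /orP[]/eqP-> /orP[]/eqP-> eq1; try by have := eq1 erefl.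
  by rewrite eqxx ab.
by rewrite eqxx (eq_sym b) ab.
Qed.

(* Classes of size at most two leave no choice; only the class of 0 may have size three,
   hence the global dichotomy. *)
Lemma class_shuffle_next_prev g E sg : uniq E -> class_shuffle g E sg ->
    {in E, forall x, size (residue_class g E x) <= 2 + (x %% g == 0)} ->
  {in E, forall x, sg x = next (residue_class g E x) x} \/
  {in E, forall x, sg x = prev (residue_class g E x) x}.
Proof.
move=> uE [sgE sg_mod sg_inj sg_fix] sizeE.
have mem_class x y : (y \in residue_class g E x) = (y == x %[mod g]) && (y \in E).
  by rewrite mem_filter.
have classE x y : x = y %[mod g] -> residue_class g E x = residue_class g E y.
  by move=> eq_xy; apply: eq_filter => w; rewrite eq_xy.
have sg_class x : x \in E -> sg x \in residue_class g E x.
  by move=> xE; rewrite mem_class sg_mod ?eqxx ?sgE.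
have fix_class x y : x \in E -> y \in residue_class g E x -> sg x = x -> x = y.
  move=> xE; rewrite mem_class => /andP[/eqP eq_yx yE] fix_x.
  by apply: sg_fix.
have small x : x \in E -> size (residue_class g E x) <= 2 ->
    sg x = next (residue_class g E x) x /\ sg x = prev (residue_class g E x) x.
  move=> xE le2; apply: next_prev_pair => //.
  - by rewrite filter_uniq.
  - by rewrite mem_class eqxx.
  - exact: sg_class.
  move=> /esym fix_x; apply: (@uniq_leq_size _ _ [:: x]); first by rewrite filter_uniq.
  by move=> y /(fix_class x y xE)/(_ fix_x) <-; rewrite mem_head.
have [le2|gt2] := leqP (size (residue_class g E 0)) 2.
  left=> x xE; have := sizeE x xE; have [/eqP x0 _|_] := boolP (x %% g == 0).
    have [|//] := small x xE.
    by rewrite (classE x 0) // x0 mod0n.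
  by rewrite addn0 => /(small x xE)[].
have big x : x \in E -> x %% g == 0 -> x \in residue_class g E 0.
  by move=> xE x0; rewrite mem_class mod0n x0.
have cl0E x : x \in residue_class g E 0 ->
    [/\ x \in E, residue_class g E x = residue_class g E 0,
       size (residue_class g E 0) <= 3 & sg x \in residue_class g E 0].
  rewrite mem_class => /andP[/eqP x0 xE]; have := sizeE x xE.
  have := sg_class x xE; rewrite (classE x 0) // x0 mod0n eqxx => ? ?.
  by split.
suff : {in residue_class g E 0, forall x, sg x = next (residue_class g E 0) x} \/
       {in residue_class g E 0, forall x, sg x = prev (residue_class g E 0) x}.
  case=> sg0; [left | right] => x xE; have := sizeE x xE.
    have [/(big x xE) x0 _|_] := boolP (x %% g == 0).
      by rewrite sg0 //; have [_ ->] := cl0E x x0.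
    by rewrite addn0 => /(small x xE)[].
  have [/(big x xE) x0 _|_] := boolP (x %% g == 0).
    by rewrite sg0 //; have [_ ->] := cl0E x x0.
  by rewrite addn0 => /(small x xE)[].
have uc : uniq (residue_class g E 0) by rewrite filter_uniq.
have inj0 : {in residue_class g E 0 &, injective sg}.
  by move=> x y /cl0E[xE _ _ _] /cl0E[yE _ _ _]; apply: sg_inj.
have fix0 : {in residue_class g E 0 &, forall x y, sg x = x -> x = y}.
  by move=> x y /cl0E[xE cx _ _] y0; apply: fix_class; rewrite ?cx.
have sg0 : {in residue_class g E 0, forall x, sg x \in residue_class g E 0}.
  by move=> x /cl0E[].
have le3 : size (residue_class g E 0) <= 3.
  by case: (residue_class g E 0) gt2 cl0E => // a ? _ /(_ a (mem_head _ _))[].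
move: (residue_class g E 0) uc gt2 le3 inj0 fix0 sg0.
case=> [|a [|b [|c []]]] //= + _ _.
rewrite !inE negb_or !andbT => /andP[/andP[ab ac] bc] inj0 fix0 sg0.
have nfix x y : x \in [:: a; b; c] -> y \in [:: a; b; c] -> x != y -> sg x != x.
  by move=> x0 y0; apply: contraNneq => /(fix0 x y x0 y0)/eqP.
have {}inj0 x y : x \in [:: a; b; c] -> y \in [:: a; b; c] -> x != y -> sg x != sg y.
  by move=> x0 y0; apply: contraNneq => /(inj0 x y x0 y0)/eqP.
have [a0 b0 c0] : [/\ a \in [:: a; b; c], b \in [:: a; b; c] & c \in [:: a; b; c]].
  by rewrite !inE !eqxx !orbT.
have ca : c != a by rewrite eq_sym.
have := nfix a b a0 b0 ab; have := nfix b c b0 c0 bc; have := nfix c a c0 a0 ca.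
have := inj0 a b a0 b0 ab; have := inj0 a c a0 c0 ac; have := inj0 b c b0 c0 bc.
have := sg0 a a0; have := sg0 b b0; have := sg0 c c0; rewrite !inE.
have ba : b != a by rewrite eq_sym.
have cb : c != b by rewrite eq_sym.
(* Of the 27 possible images of (a, b, c), injectivity and absence of fixed points leave only the
   two 3-cycles. *)
by case/or3P=> /eqP Hc; case/or3P=> /eqP Hb; case/or3P=> /eqP Ha;
  rewrite Ha Hb Hc ?eqxx // => _ _ _ _ _ _; [left | right] => x;
  rewrite !inE => /or3P[]/eqP->; rewrite /= ?eqxx ?(negPf ab) ?(negPf ac)
    ?(negPf bc) ?(negPf ba) ?(negPf ca) ?(negPf cb).
Qed.

(* Found by search; only the last of these sets has no class with three points. *)
Definition sporadic_columns d : seq nat :=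
  if d == 60 then [:: 0; 3; 4; 7; 8; 11; 12]
  else if d == 120 then [:: 0; 1; 2; 3; 5; 6; 7]
  else if d == 180 then [:: 0; 1; 2; 3; 4; 5; 6]
  else [:: 0; 1; 4; 5; 6].

(** A decidable criterion for [good_columns]: the size bound reduces the quantification over [sg] to
    the two candidates [next] and [prev]. *)
Definition class_check g d (E : seq nat) :=
  [&& 0 \in E, sorted ltn E, all (fun x => x <= d) E,
      all (fun r => has (fun x => x %% g == r) E) (iota 0 g),
      all (fun x => size (residue_class g E x) <= 2 + (x %% g == 0)) E,
      late_return (fun x => advance E d (next (residue_class g E x) x)) (size E)
    & late_return (fun x => advance E d (prev (residue_class g E x) x)) (size E)].

Lemma good_columns_check g d E : 0 < g -> class_check g d E -> good_columns g d E.
Proof.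
move=> g_gt0 /and5P[E0 sE /allP leE /allP clE /and3P[/allP sizeE nextE prevE]].
split=> //.
  move=> x; have xg : x %% g \in iota 0 g by rewrite mem_iota ltn_mod.
  by have /hasP[y yE /eqP eq_yx] := clE _ xg; exists y.
move=> sg shuffle; have [sgE _ _ _] := shuffle.
have advE x : x \in E -> advance E d (sg x) \in E.
  by move=> _; apply: mem_advance; case: (E) E0.
have uE : uniq E := sorted_uniq ltn_trans ltnn sE.
by have [eq_sg|eq_sg] := class_shuffle_next_prev uE shuffle sizeE;
  rewrite (eq_in_late_return _ _ (fun x xE => congr1 (advance E d) (eq_sg x xE))).
Qed.

Lemma good_columns_sporadic d : sporadic d -> good_columns 3 d (sporadic_columns d).
Proof.
move=> sp; apply: good_columns_check => //.
have /allP := (isT : all (fun d => class_check 3 d (sporadic_columns d))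
  [:: 12; 48; 60; 72; 108; 120; 132; 168; 180; 192]).
exact.
Qed.

Lemma ex_good_columns d g : 0 < d < 199 -> ~~ odd d -> odd g -> g %| d ->
  exists E, good_columns g d E.
Proof.
move=> d_bnd even_d odd_g dvd_gd; have [d_gt0 _] := andP d_bnd.
have g_gt0 : 0 < g by case: g odd_g {dvd_gd}.
have [[t ok_t]|[-> sp]] := ex_contiguous d_bnd even_d odd_g dvd_gd; last first.
  by exists (sporadic_columns d); apply: good_columns_sporadic.
exists (iota 0 (g + t)); apply: good_columns_iota => //.
have /andP[le_tg _] := ok_t.
(* As d is even and g is odd, the quotient d / g is at least 2, whence g + t <= 2g <= d. *)
case/dvdnP: dvd_gd => -[|[|q]] def_d; rewrite def_d in d_gt0 even_d *.
- by [].
- by rewrite mul1n odd_g in even_d.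
by rewrite !mulSn addnA leqW // (leq_trans _ (leq_addr _ _)) // leq_add2l.
Qed.

(** * Reachability by steps of constant length *)

(** Here c lists the cells of one diagonal by column: the tour slides along it, u columns at a time,
    until a column of E sends it to the diagonal c'. *)
Lemma fconnect_run (T : finType) (f : T -> T) (c c' : nat -> T) (hit : pred nat) u :
    (forall j, f (c j) = if hit (j + u) then c' (j + u) else c (j + u)) ->
  forall p j, 0 < p -> (forall q, 0 < q < p -> ~~ hit (j + q * u)) ->
    hit (j + p * u) -> fconnect f (c j) (c' (j + p * u)).
Proof.
move=> fc; elim=> [|[|p] IHp] j // _ no_hit hit_p.
  by rewrite mul1n in hit_p *; have := fconnect1 f (c j); rewrite fc hit_p.
apply: connect_trans (fconnect1 _ _) _; rewrite fc.
have /negPf -> : ~~ hit (j + u) by have := no_hit 1; rewrite mul1n; apply.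
rewrite mulSn addnA in hit_p *; apply: IHp => // q /andP[q_gt0 lt_q].
by rewrite -addnA -mulSn; apply: no_hit.
Qed.

Lemma modn_reach n u x y : 0 < n -> x = y %[mod gcdn n u] ->
  exists2 q, 0 < q & x + q * u = y %[mod n].
Proof.
move=> n_gt0 eq_xy; have [u0|u_gt0] := posnP u.
  by exists 1 => //; rewrite u0 muln0 addn0; rewrite u0 gcdn0 in eq_xy.
case: (egcdnP n u_gt0) => /= a b eq_ab _.
(* [x * n.-1] stands for -x modulo n, which avoids truncated subtraction. *)
have dvd_z : gcdn u n %| y + x * n.-1.
  rewrite gcdnC /dvdn -modnDml -eq_xy modnDml -mulnS prednK //.
  by rewrite -/(dvdn _ _) dvdn_mull // dvdn_gcdl.
(* The summand n makes the number of steps positive and changes nothing modulo n. *)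
exists ((y + x * n.-1) %/ gcdn u n * a + n); first by rewrite addn_gt0 n_gt0 orbT.
rewrite mulnDl -mulnA eq_ab mulnDr divnK //; set w := _ %/ _.
have -> : x + (w * (b * n) + (y + x * n.-1) + n * u) = (x + w * b + u) * n + y.
  by rewrite -(prednK n_gt0) /=; ring.
by rewrite modnMDl.
Qed.

(** * The move function as a permutation *)

Lemma row_succE n (A : array n) i j :
  row_succ A (i, j) = (i, next_in (fun j' => (i, j') \in filled A) j).
Proof. by rewrite permE. Qed.

Lemma col_succE n (A : array n) i j :
  col_succ A (i, j) = (next_in (fun i' => (i', j) \in filled A) i, j).
Proof. by rewrite permE. Qed.

Lemma row_succ_row n (A : array n) x : (row_succ A x).1 = x.1.
Proof. by rewrite permE. Qed.

Lemma col_succ_col n (A : array n) x : (col_succ A x).2 = x.2.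
Proof. by rewrite permE. Qed.

Lemma row_succ_out n (A : array n) x : x \notin filled A -> row_succ A x = x.
Proof.
by case: x => i j /negPf xF; rewrite row_succE /next_in xF.
Qed.

Lemma col_succ_out n (A : array n) x : x \notin filled A -> col_succ A x = x.
Proof.
by case: x => i j /negPf xF; rewrite col_succE /next_in xF.
Qed.

Section MovePerm.

Variables (n : nat) (A : array n) (R C : {ffun 'I_n -> int}).

Let row_back (x : 'I_n * 'I_n) := R x.1 == (-1)%R.
Let col_back (x : 'I_n * 'I_n) := C x.2 == (-1)%R.

Let row_backS x : row_back (row_succ A x) = row_back x.
Proof. by rewrite /row_back row_succ_row. Qed.

Let col_backS x : col_back (col_succ A x) = col_back x.
Proof. by rewrite /col_back col_succ_col. Qed.

Definition move_perm : {perm 'I_n * 'I_n} :=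
  (flip row_backS * flip col_backS)%g.

Lemma move_permE : sign_vector R -> sign_vector C ->
  move_perm =1 move_fun A R C.
Proof.
move=> signR signC x; rewrite permM /move_fun.
have expzE (s : {perm 'I_n * 'I_n}) e y : e = 1%R \/ e = (-1)%R ->
    perm_expz s e y = if e == (-1)%R then (s^-1)%g y else s y.
  by case=> ->; rewrite /= expg1.
by rewrite !expzE // !flipE.
Qed.

(** Reversals do not affect parity, so neither R nor C appears on the right. *)
Lemma odd_move_perm :
  odd_perm move_perm = odd_perm (row_succ A) (+) odd_perm (col_succ A).
Proof. by rewrite odd_permM !odd_flip. Qed.

Lemma move_perm_out x : x \notin filled A -> move_perm x = x.
Proof.
move=> xF; have flip_id (s : {perm 'I_n * 'I_n}) b (bs : forall y, b (s y) = b y) :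
    s x = x -> flip bs x = x.
  by move=> sx; rewrite flipE sx -{2}sx permK if_same.
by rewrite permM !flip_id ?row_succ_out ?col_succ_out.
Qed.

End MovePerm.

(** * Successors in diagonal coordinates *)

Section Cells.

Variables (n k : nat) (A : array n) (a : 'I_n).
Hypotheses (k_gt0 : 0 < k) (lt_kn : k < n).
Hypothesis filledE : filled A = \bigcup_(m < k) diagonal (shift a m).

Let z : 'I_n := Ordinal (ltn_trans k_gt0 lt_kn).

(* The cell of the m-th filled diagonal lying in column j, with j read modulo n. *)
Definition cell m j : 'I_n * 'I_n := (shift a (m + j), shift z j).

Lemma eq_cell m m' j j' : (cell m j == cell m' j') =
  (m + j == m' + j' %[mod n]) && (j == j' %[mod n]).
Proof. by rewrite /cell xpair_eqE !shift_eqE. Qed.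

Lemma val_cell_col m j : (cell m j).2 = j %% n :> nat.
Proof. by rewrite val_shift. Qed.

Lemma cell_ord m (j : 'I_n) : cell m j = (shift (shift a m) j, j).
Proof.
rewrite /cell shiftD; congr (_, _).
by apply: ord_inj; rewrite val_shift add0n modn_small.
Qed.

Lemma cell_mod m j : cell m (j %% n) = cell m j.
Proof. by apply/eqP; rewrite eq_cell modnDmr !modn_mod !eqxx. Qed.

Lemma cell_modD m j : cell (m + n) j = cell m j.
Proof. by apply/eqP; rewrite eq_cell addnAC modnDr !eqxx. Qed.

Lemma filledP x :
  reflect (exists m j, m < k /\ x = cell m j) (x \in filled A).
Proof.
rewrite filledE; apply: (iffP bigcupP) => [[m _ /imsetP[t _ ->]]|[m [j [lt_m ->]]]].
  by exists m, t; rewrite cell_ord.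
exists (Ordinal lt_m) => //=; apply/imsetP.
exists (shift z j) => //; rewrite -(cell_mod m j) -(val_cell_col m).
by rewrite cell_ord.
Qed.

Lemma cell_filled m j : m < n -> (cell m j \in filled A) = (m < k).
Proof.
move=> lt_mn; apply/filledP/idP => [[m' [j' [lt_m' /eqP]]]|lt_mk]; last by exists m, j.
rewrite eq_cell => /andP[/eqP eq_m /eqP eq_j].
move/eqP: eq_m; rewrite -modnDmr eq_j modnDmr eqn_modDr.
by rewrite !modn_small ?(ltn_trans lt_m') // => /eqP->.
Qed.

Lemma card_filled : #|filled A| = n * k.
Proof.
have -> : filled A = [set cell mj.1 mj.2 | mj : 'I_k * 'I_n].
  apply/setP=> x; apply/filledP/imsetP => [[m [j [lt_m ->]]]|[[m j] _ ->]].
    exists (Ordinal lt_m, shift z j) => //=.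
    by rewrite -(cell_mod m j) val_shift.
  by exists m, j.
rewrite card_imset ?card_prod ?card_ord 1?mulnC // => -[m j] [m' j'] /= /eqP.
rewrite eq_cell => /andP[/eqP eq_m /eqP eq_j].
have lt_m := ltn_trans (ltn_ord m) lt_kn; have lt_m' := ltn_trans (ltn_ord m') lt_kn.
rewrite !modn_small // in eq_j; have ? := ord_inj eq_j; subst j'.
move/eqP: eq_m; rewrite eqn_modDr !modn_small // => /eqP eq_m.
by rewrite (ord_inj eq_m).
Qed.

Lemma row_succ_cellS m j : m.+1 < k -> row_succ A (cell m.+1 j) = cell m j.+1.
Proof.
move=> lt_m; have eq_row : shift a (m.+1 + j) = shift a (m + j.+1).
  by rewrite addSnnS.
rewrite /cell row_succE eq_row (@next_in_eq _ _ _ 1) ?shiftD ?addn1 //.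
- by rewrite -eq_row -/(cell _ _) cell_filled // (ltn_trans lt_m).
- by rewrite -/(cell _ j.+1) cell_filled; lia.
by case=> [|[]].
Qed.

(** A step to the right inside a row lowers the diagonal by one modulo n, so from diagonal 0 the
    first filled diagonal met is k - 1, after n - (k - 1) columns. *)
Lemma row_succ_cell0 j : row_succ A (cell 0 j) = cell k.-1 (j + (n - k.-1)).
Proof.
have rowE q : q <= n -> shift a (0 + j) = shift a (n - q + (j + q)).
  move=> le_q; apply/eqP; rewrite shift_eqE add0n addnA addnAC subnK //.
  by rewrite modnDl.
rewrite /cell row_succE.
rewrite (@next_in_eq _ _ _ (n - k.-1)) ?shiftD //.
- congr (_, _); rewrite (rowE (n - k.-1)) ?leq_subr // subKn //; lia.
- by rewrite -/(cell 0 j) cell_filled //; lia.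
- by rewrite subn_gt0; lia.
- rewrite (rowE (n - k.-1)) ?leq_subr // -/(cell _ _) cell_filled; lia.
move=> q /andP[q_gt0 lt_q]; rewrite shiftD (rowE q); last by lia.
rewrite -/(cell _ _) cell_filled; lia.
Qed.

Lemma col_succ_cellS m j : m.+1 < k -> col_succ A (cell m j) = cell m.+1 j.
Proof.
move=> lt_m; rewrite /cell col_succE.
have colE : shift (shift a (m + j)) 1 = shift a (m.+1 + j) by rewrite shiftD addn1.
rewrite (@next_in_eq _ _ _ 1) ?colE //.
- by rewrite -/(cell m j) cell_filled; lia.
- by rewrite -/(cell m.+1 j) cell_filled; lia.
by case=> [|[]].
Qed.

Lemma col_succ_cell_last j : col_succ A (cell k.-1 j) = cell 0 j.
Proof.
have colE q : shift (shift a (k.-1 + j)) q = shift a (k.-1 + q + j).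
  by rewrite shiftD addnAC.
have -> : cell 0 j = cell (k.-1 + (n - k.-1)) j.
  by rewrite subnKC ?(cell_modD 0) //; lia.
rewrite /cell col_succE.
rewrite (@next_in_eq _ _ _ (n - k.-1)) ?colE //.
- by rewrite -/(cell _ _) cell_filled; lia.
- by rewrite subn_gt0; lia.
- rewrite -/(cell _ _) subnKC; last by lia.
  by rewrite (cell_modD 0) cell_filled; lia.
move=> q /andP[q_gt0 lt_q]; rewrite colE.
rewrite -/(cell _ _) cell_filled; lia.
Qed.

(** * Reflection in the antidiagonal, and necessity *)

Definition antitranspose (x : 'I_n * 'I_n) := (rev_ord x.2, rev_ord x.1).

Lemma antitransposeK : involutive antitranspose.
Proof. by case=> i j; rewrite /antitranspose /= !rev_ordK. Qed.

(** The reflection sends (i, j) to (n - 1 - j, n - 1 - i), which preserves i - j and hence the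
    diagonal. *)
Lemma antitranspose_cell m j :
  antitranspose (cell m j) = cell m (rev_ord (shift a (m + j))).
Proof.
rewrite cell_ord /antitranspose /cell; congr (_, _).
rewrite shiftC -[LHS](shift_rev _ (shift a m)); congr (shift (rev_ord _) _).
by apply: ord_inj; rewrite !val_shift add0n modnDml modnDmr addnC addnA.
Qed.

(** Moving down becomes moving left under the reflection, which maps the filled set to itself. *)
Lemma row_succ_antitranspose x :
  row_succ A (antitranspose (col_succ A x)) = antitranspose x.
Proof.
have [xF|xF] := boolP (x \in filled A); last first.
  rewrite col_succ_out // row_succ_out //.
  apply: contra xF => /filledP[m [j [lt_m eq_x]]].
  rewrite -[x]antitransposeK eq_x antitranspose_cell.
  by apply/filledP; exists m, (rev_ord (shift a (m + j))).
have {x xF} /filledP[m [j [lt_m ->]]] := xF.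
have revD p q : rev_ord (shift a (p + q)) + q = rev_ord (shift a p) %[mod n].
  by rewrite -shiftD -val_shift shift_rev modn_small.
have [lt_m1|ge_m] := ltnP m.+1 k.
  rewrite col_succ_cellS // !antitranspose_cell row_succ_cellS //.
  apply/eqP; rewrite eq_cell eqn_modDl andbb -addn1.
  by have := revD (m + j) 1; rewrite (addn1 (m + j)) -addSn => ->.
have -> : m = k.-1 by lia.
rewrite col_succ_cell_last !antitranspose_cell row_succ_cell0.
apply/eqP; rewrite eq_cell eqn_modDl andbb -(eqn_modDr k.-1) -addnA subnK; last by lia.
by rewrite modnDr -(revD _ k.-1) add0n (addnC j).
Qed.

Lemma odd_row_col_succ : odd_perm (row_succ A) = odd_perm (col_succ A).
Proof.
pose t := perm (inv_inj antitransposeK).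
have -> : row_succ A = ((col_succ A)^-1 ^ t)%g.
  apply/permP => x; rewrite conjgE !permM.
  have tV : (t^-1)%g = t.
    apply/permP => y; apply: (@perm_inj _ t); rewrite permKV.
    by rewrite !permE antitransposeK.
  rewrite tV [RHS]permE -row_succ_antitranspose permKV; congr (row_succ A _).
  by rewrite permE antitransposeK.
by rewrite odd_permJ odd_permV.
Qed.

Lemma has_solution_odd : has_solution A -> odd n /\ odd k.
Proof.
move=> [R [C [signR signC [p cyc_p eq_p]]]]; apply/andP; rewrite -oddM -card_filled.
have moveE := move_permE A signR signC.
have := @odd_perm_ufcycle _ (move_perm A R C) p (filled A).
rewrite odd_move_perm odd_row_col_succ addbb => /(_ _ eq_p) oddF.
apply/negbFE/esym/oddF; first by rewrite /ucycle /ucycleb (eq_fcycle moveE).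
  by rewrite -card_gt0 card_filled muln_gt0 k_gt0 (ltn_trans _ lt_kn).
exact: move_perm_out.
Qed.

(** * The tour with all rows forward and the columns of E reversed *)

Section Tour.

Variable E : seq nat.
Hypotheses (odd_k : odd k) (k_gt2 : 2 < k).
Hypothesis goodE : good_columns (gcdn n k.-1) k.-1 E.

Let E0 : 0 \in E. Proof. by case: goodE. Qed.
Let sortedE : sorted ltn E. Proof. by case: goodE. Qed.
Let uniqE : uniq E := sorted_uniq ltn_trans ltnn sortedE.
Let ltE x : x \in E -> x < n.
Proof. by case: goodE => _ _ leE _ _ /leE le_x; lia. Qed.
Let s_gt0 : 0 < size E. Proof. by case: (E) E0. Qed.

Definition tour_rows : {ffun 'I_n -> int} := [ffun=> 1%R].
Definition tour_cols : {ffun 'I_n -> int} :=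
  [ffun j : 'I_n => if (j : nat) \in E then (-1)%R else 1%R].

Lemma tour_rows_sign : sign_vector tour_rows.
Proof. by move=> i; rewrite ffunE; left. Qed.

Lemma tour_cols_sign : sign_vector tour_cols.
Proof. by move=> j; rewrite ffunE; case: ifP; [right | left]. Qed.

Let tour := move_fun A tour_rows tour_cols.
Let tour_permE : move_perm A tour_rows tour_cols =1 tour :=
  move_permE A tour_rows_sign tour_cols_sign.

Lemma tour_inj : injective tour.
Proof. by move=> x y; rewrite -!tour_permE => /perm_inj. Qed.

Lemma tourE x m j : row_succ A x = cell m j ->
  tour x = if j %% n \in E then ((col_succ A)^-1)%g (cell m j)
           else col_succ A (cell m j).
Proof.
move=> xE; rewrite /tour /move_fun [tour_rows _]ffunE /= expg1 xE ffunE.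
by rewrite val_cell_col; case: ifP; rewrite /= expg1.
Qed.

(** The row step leads to diagonal m in the next column. The column step then goes back up to m + 1,
    or in a reversed column down to m - 1, read as k - 1 when m = 0. *)
Lemma tour_cellS m j : m.+1 < k ->
  tour (cell m.+1 j) = if (j + 1) %% n \in E
    then cell (if m is m'.+1 then m' else k.-1) (j + 1) else cell m.+1 (j + 1).
Proof.
move=> lt_m; rewrite addn1 (tourE (row_succ_cellS j lt_m)) col_succ_cellS //.
case: ifP => // _; case: m lt_m => [|m] lt_m.
  by rewrite -col_succ_cell_last permK.
by rewrite -col_succ_cellS ?permK // ltnW.
Qed.

Lemma tour_cell0 j : tour (cell 0 j) = if (j + (n - k.-1)) %% n \in E
  then cell k.-2 (j + (n - k.-1)) else cell 0 (j + (n - k.-1)).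
Proof.
rewrite (tourE (row_succ_cell0 j)) col_succ_cell_last; case: ifP => // _.
have -> : cell k.-1 (j + (n - k.-1)) = col_succ A (cell k.-2 (j + (n - k.-1))).
  by rewrite col_succ_cellS; [congr cell|]; lia.
by rewrite permK.
Qed.

Let hit j := j %% n \in E.
Let conn := fconnect tour.

Let connC x y : conn x y = conn y x.
Proof. exact: fconnect_sym tour_inj x y. Qed.

(** E in increasing order, enumerated cyclically. *)
Let e i := nth 0 E (i %% size E).

Let eE i : e i \in E. Proof. by rewrite mem_nth ?ltn_mod. Qed.

Let e_index x : x \in E -> e (index x E) = x.
Proof. by move=> xE; rewrite /e modn_small ?index_mem // nth_index. Qed.

Let e_mod i : e (i %% size E) = e i.
Proof. by rewrite /e modn_mod. Qed.

Let nthE_lt i : i < size E -> nth 0 E i < n.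
Proof. by move=> lt_i; rewrite ltE ?mem_nth. Qed.

Let nthE_homo i j : i < j -> j < size E -> nth 0 E i < nth 0 E j.
Proof.
move=> lt_ij lt_j; apply: (sorted_ltn_nth ltn_trans 0 sortedE) => //.
by rewrite inE (ltn_trans lt_ij).
Qed.

Let nthE_mono i j : i < size E -> j < size E -> nth 0 E i < nth 0 E j -> i < j.
Proof.
move=> lt_i lt_j; rewrite ltnNge; apply: contraNltn => le_ji.
have [->//|neq] := eqVneq j i.
by rewrite ltnW // nthE_homo // ltn_neqAle neq.
Qed.

Let nthE0 : nth 0 E 0 = 0.
Proof.
have := E0; rewrite -index_mem => lt_i; have := nth_index 0 E0.
case: (index 0 E) lt_i => // i lt_i eq0.
by have := nthE_homo (ltn0Sn i) lt_i; rewrite eq0.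
Qed.

Lemma tour_next_column m i : m.+1 < k ->
  conn (cell m.+1 (e i)) (cell (if m is m'.+1 then m' else k.-1) (e i.+1)).
Proof.
move=> lt_m; have -> : e i.+1 = e (i %% size E).+1.
  by rewrite /e -[in LHS]addn1 -modnDml addn1.
rewrite -(e_mod i); have := ltn_pmod i s_gt0; move: (i %% size E) => {}i lt_i.
rewrite /e (modn_small lt_i).
have run := fconnect_run (hit := hit) (c' := cell (if m is m'.+1 then m' else k.-1))
  (fun j => tour_cellS j lt_m).
have lt_en := nthE_lt lt_i.
have [lt_i1|ge_i1] := ltnP i.+1 (size E).
  have lt_e := nthE_homo (ltnSn i) lt_i1; have lt_e1n := nthE_lt lt_i1.
  have := run (nth 0 E i.+1 - nth 0 E i) (nth 0 E i).
  rewrite muln1 (subnKC (ltnW lt_e)) (modn_small lt_i1); apply.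
  - by rewrite subn_gt0.
  - move=> q /andP[q_gt0 lt_q]; rewrite /hit muln1 modn_small; last by lia.
    apply/negP => /(nthP 0)[l lt_l eq_l].
    have := nthE_mono lt_i lt_l; have := nthE_mono lt_l lt_i1.
    by rewrite eq_l; lia.
  by rewrite /hit modn_small // mem_nth.
(* After the last column of E the tour runs on to column n, which is column 0, the first element of
   E. *)
have -> : i.+1 = size E by apply/eqP; rewrite eqn_leq lt_i.
rewrite modnn nthE0; have := run (n - nth 0 E i) (nth 0 E i).
rewrite muln1 (subnKC (ltnW lt_en)) -(cell_mod _ n) /hit modnn; apply => //.
- by rewrite subn_gt0.
- move=> q /andP[q_gt0 lt_q]; rewrite /hit muln1 modn_small; last by lia.
  apply/negP => /(nthP 0)[l lt_l eq_l].
  have lt_il : i < l.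
    by apply: nthE_mono => //; rewrite eq_l -[ltnLHS]addn0 ltn_add2l.
  by have := leq_trans lt_l ge_i1; rewrite ltnS leqNgt lt_il.
Qed.

Lemma tour_even b i : b.*2 < k -> conn (cell b.*2 (e i)) (cell 0 (e (i + b))).
Proof.
elim: b i => [|b IHb] i lt_b; first by rewrite addn0; apply: connect0.
rewrite doubleS in lt_b *; apply: connect_trans (tour_next_column i lt_b) _.
by rewrite addnS -addSn; apply: IHb; lia.
Qed.

(** It takes b + 1 passages through columns of E to go from diagonal 2b + 1 past 1 to k - 1, which
    is even, and k./2 more to reach 0. *)
Lemma tour_odd b i : b.*2.+1 < k ->
  conn (cell b.*2.+1 (e i)) (cell 0 (e (i + b.+1 + k./2))).
Proof.
elim: b i => [|b IHb] i lt_b; apply: connect_trans (tour_next_column i lt_b) _.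
  have -> : k.-1 = k./2.*2 by rewrite -[k in LHS]odd_double_half odd_k.
  by rewrite addn1; apply: tour_even; rewrite -[ltnRHS]odd_double_half odd_k.
by rewrite addnS -addSn; apply: IHb; rewrite doubleS in lt_b; lia.
Qed.

(** With k - 2 = 2b + 1 the total is (b + 1) + k./2 = k - 1 passages. *)
Lemma tour_advance x : x \in E -> conn (cell k.-2 x) (cell 0 (advance E k.-1 x)).
Proof.
move=> xE; rewrite -[in cell k.-2 x](e_index xE).
have k2E : k.-2 = (k./2.-1).*2.+1.
  by rewrite -[k in LHS]odd_double_half odd_k; lia.
have -> : advance E k.-1 x = e (index x E + k./2.-1.+1 + k./2).
  congr (nth 0 E (_ %% _)); rewrite -addnA; congr (_ + _).
  by rewrite -[k in LHS]odd_double_half odd_k; lia.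
by rewrite k2E; apply: tour_odd; lia.
Qed.

Lemma tour_to_diagonal0 m x : m < k -> x \in E ->
  exists2 y, y \in E & conn (cell m x) (cell 0 y).
Proof.
move=> lt_m xE; rewrite -(e_index xE) -(odd_double_half m).
rewrite -(odd_double_half m) in lt_m; case: (odd m) lt_m => lt_m.
  by exists (e (index x E + (m./2).+1 + k./2)); rewrite ?eE // tour_odd.
by exists (e (index x E + m./2)); rewrite ?eE // tour_even.
Qed.

(** * First return to E along diagonal 0 *)

Let u := n - k.-1.

Let gcd_u : gcdn n u = gcdn n k.-1.
Proof.
have : n = u + k.-1 by rewrite subnK // (leq_trans (leq_pred k)) // ltnW.
by move: u => w ->; rewrite gcdnC gcdnDl [RHS]gcdnC gcdnDr gcdnC.
Qed.

Lemma ex_return x : exists p, (0 < p) && hit (x + p * u).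
Proof.
have [_ _ _ /(_ x)[y yE eq_xy] _] := goodE.
rewrite -gcd_u in eq_xy.
have [p p_gt0 eq_p] := modn_reach (ltn_trans k_gt0 lt_kn) eq_xy.
by exists p; rewrite p_gt0 /hit eq_p modn_small ?ltE.
Qed.

Definition return_time x := ex_minn (ex_return x).
Definition return_col x := (x + return_time x * u) %% n.

Lemma return_timeP x : [/\ 0 < return_time x, hit (x + return_time x * u) &
  forall q, 0 < q < return_time x -> ~~ hit (x + q * u)].
Proof.
rewrite /return_time; case: ex_minnP => p /andP[p_gt0 hit_p] min_p; split=> //.
move=> q /andP[q_gt0]; rewrite ltnNge; apply: contra => hit_q.
by apply: min_p; rewrite q_gt0.
Qed.

Lemma tour_return x : conn (cell 0 x) (cell k.-2 (return_col x)).
Proof.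
rewrite cell_mod; have [t_gt0 hit_t no_hit] := return_timeP x.
exact: (fconnect_run (hit := hit) (c' := cell k.-2) tour_cell0).
Qed.

(** If x and y return to the same column and y takes longer, the path of y meets x in E before its
    return, a contradiction. If x returns to itself, its orbit, which is its whole class, meets E
    only in x. *)
Lemma return_col_shuffle : class_shuffle (gcdn n k.-1) E return_col.
Proof.
have retE x : return_col x \in E by have [] := return_timeP x.
have stepK p x y w : 0 < p -> p <= return_time y ->
    x + p * u = w %[mod n] -> y + return_time y * u = w %[mod n] ->
    y + (return_time y - p) * u = x %[mod n].
  move=> p_gt0 le_p eq_x eq_y; apply/eqP; rewrite -(eqn_modDr (p * u)) -addnA -mulnDl.
  by rewrite subnK // eq_x eq_y.
split.
- by move=> x _; apply: retE.
- move=> x _; rewrite /return_col modn_dvdm ?dvdn_gcdl // -modnDmr -gcd_u.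
  have /eqP -> : gcdn n u %| return_time x * u by rewrite dvdn_mull ?dvdn_gcdr.
  by rewrite addn0.
- move=> x y xE yE eq_xy; wlog le_xy : x y xE yE eq_xy / return_time x <= return_time y.
    move=> IH.
    case/orP: (leq_total (return_time x) (return_time y)) => le; first exact: IH.
    by apply/esym/IH.
  have [tx_gt0 _ _] := return_timeP x; have [_ _ no_hit] := return_timeP y.
  have := stepK _ _ _ _ tx_gt0 le_xy eq_xy erefl => eq_yx.
  have [le_yx|gt_yx] := leqP (return_time y) (return_time x); last first.
    have lt_t : 0 < return_time y - return_time x < return_time y.
      by rewrite subn_gt0 gt_yx ltn_subrL tx_gt0 (ltn_trans tx_gt0).
    by case/negP: (no_hit _ lt_t); rewrite /hit eq_yx modn_small ?ltE.
  move: eq_yx; rewrite (eqP (_ : return_time y - return_time x == 0)) ?subn_eq0 //.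
  by rewrite addn0 !modn_small ?ltE.
move=> x y xE yE eq_xy fix_x; apply/eqP; rewrite -[_ == _]negbK; apply/negP => neq_xy.
rewrite -gcd_u in eq_xy.
have [p p_gt0 eq_p] := modn_reach (ltn_trans k_gt0 lt_kn) eq_xy.
have [t_gt0 _ no_hit] := return_timeP x.
(* Since x returns to itself, whole return times can be subtracted from p until p is at most one
   return time. *)
elim/ltn_ind: p p_gt0 eq_p => p IHp p_gt0 eq_p.
have [lt_pt|] := ltnP p (return_time x).
  have := no_hit p; rewrite p_gt0 lt_pt => /(_ isT)/negP[].
  by rewrite /hit eq_p modn_small ?ltE.
rewrite leq_eqVlt => /predU1P[eq_t|lt_tp].
  by case/eqP: neq_xy; rewrite -fix_x /return_col eq_t eq_p modn_small ?ltE.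
apply: (IHp (p - return_time x)); rewrite ?subn_gt0 //.
  by rewrite ltn_subrL t_gt0.
rewrite -eq_p; have -> : x + p * u = x + return_time x * u + (p - return_time x) * u.
  by rewrite -addnA -mulnDl subnKC // ltnW.
by rewrite -(modnDml (x + return_time x * u)) -/(return_col x) fix_x.
Qed.

Lemma tour_diagonal0 x : x \in E -> conn (cell 0 0) (cell 0 x).
Proof.
have [_ _ _ _ /(_ _ return_col_shuffle) late] := goodE.
have [retE _ ret_inj _] := return_col_shuffle.
move=> xE; have [||q ->] := late_return_covers uniqE E0 _ _ late xE.
- by move=> y _; apply: mem_advance.
- by move=> y w yE wE /(advance_inj uniqE)-/(_ (retE y yE) (retE w wE)); apply: ret_inj.
suff [] : iter q (fun y => advance E k.-1 (return_col y)) 0 \in E /\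
  conn (cell 0 0) (cell 0 (iter q (fun y => advance E k.-1 (return_col y)) 0)) by [].
elim: q => [|q [IHE IHconn]] /=; first by split; [| apply: connect0].
split; first exact: mem_advance.
apply: connect_trans IHconn (connect_trans (tour_return _) _).
by apply: tour_advance; apply: retE.
Qed.

Lemma tour_cell_to_column m j : m < k ->
  exists m' x, [/\ m' < k, x \in E & conn (cell m j) (cell m' x)].
Proof.
case: m => [_|m lt_m].
  exists k.-2, (return_col j); split; last exact: tour_return.
    by rewrite -subn2 ltn_subrL k_gt0.
  by have [] := return_timeP j.
have ex_hit : exists p, (0 < p) && hit (j + p * 1).
  (* This many steps lead to column 0, which is in E. *)
  exists (n - j %% n); rewrite muln1 subn_gt0 ltn_mod (ltn_trans k_gt0 lt_kn) /=.
  by rewrite /hit -modnDml subnKC ?modnn // ltnW // ltn_mod (ltn_trans k_gt0 lt_kn).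
case: (ex_minnP ex_hit) => p /andP[p_gt0 hit_p] min_p.
exists (if m is m'.+1 then m' else k.-1), ((j + p * 1) %% n); split=> //.
  by case: (m) lt_m; lia.
rewrite cell_mod.
apply: (fconnect_run (hit := hit) (fun j => tour_cellS j lt_m)) => // q /andP[q_gt0].
by rewrite ltnNge; apply: contra => hit_q; apply: min_p; rewrite q_gt0.
Qed.

(** Every cell leads to diagonal 0 in a column of E; connectedness is symmetric because the tour is
    injective on a finite type. *)
Lemma tour_connected x : x \in filled A -> conn (cell 0 0) x.
Proof.
move=> /filledP[m [j [lt_m ->]]].
have [m' [y [lt_m' yE conn_y]]] := tour_cell_to_column j lt_m.
have [w wE conn_w] := tour_to_diagonal0 lt_m' yE.
apply: connect_trans (tour_diagonal0 wE) _.
by rewrite -/(conn _ _) connC; apply: connect_trans conn_y conn_w.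
Qed.

Lemma tour_filled x : (tour x \in filled A) = (x \in filled A).
Proof.
rewrite -tour_permE; apply/idP/idP; apply: contraTT => xF.
  by rewrite move_perm_out.
suff <- : move_perm A tour_rows tour_cols x = x by [].
by apply: (@perm_inj _ (move_perm A tour_rows tour_cols)); rewrite move_perm_out.
Qed.

Lemma tour_solution : has_solution A.
Proof.
exists tour_rows, tour_cols; split; [exact: tour_rows_sign | exact: tour_cols_sign |].
exists (fingraph.orbit tour (cell 0 0)).
  by rewrite /ucycle /ucycleb orbit_uniq cycle_orbit //; apply: tour_inj.
move=> x; rewrite -fconnect_orbit; apply/idP/idP => [/iter_findex <-|].
  elim: (findex _ _ _) => [|q]; first by apply/filledP; exists 0, 0.
  by rewrite iterS tour_filled.
exact: tour_connected.
Qed.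

End Tour.

End Cells.

Theorem theorem4p11 (k n : nat) (A : array n)
    (hk : 3 <= k < 200) (hn : k < n) (hA : cyclically_diagonal k A) :
  has_solution A <-> odd n /\ odd k.
Proof.
have [_ _ [a filledE]] := hA; have /andP[k_gt2 lt_k] := hk.
have k_gt0 : 0 < k by apply: leq_trans k_gt2.
split=> [|[odd_n odd_k]]; first exact: has_solution_odd k_gt0 hn filledE.
have [E goodE] : exists E, good_columns (gcdn n k.-1) k.-1 E.
  apply: ex_good_columns.
  - by clear -k_gt2 lt_k; lia.
  - by move: odd_k; rewrite -{1}(prednK k_gt0).
  - exact: dvdn_odd (dvdn_gcdl _ _) odd_n.
  exact: dvdn_gcdr.
exact: (tour_solution k_gt0 hn filledE odd_k k_gt2 goodE).
Qed.
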